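(* The spherical catenaries $d\lambda=\dfrac{a}{z(1-z^2)}\,ds$ are the only spherical curves (with $z$ non-constant, up to rotations around the $z$-axis) with spherical angular momentum $\mathcal K(z)=-a/z$ (and curvature $\kappa(z)=a/z^2$), $0<a<1/2$.
   Context: $\mathbb{S}^2\subset\mathbb{R}^3$ is the unit sphere centred at the origin, with geographical coordinates latitude $\varphi$ and longitude $\lambda$, so that a spherical curve, parametrized by arc length $s$, is $\xi=(x,y,z)=(\cos\varphi\cos\lambda,\cos\varphi\sin\lambda,\sin\varphi)$; a dot denotes the derivative with respect to $s$. The geodesic curvature of $\xi$ is $\kappa=\det(\xi,\dot\xi,\ddot\xi)$. The spherical angular momentum of $\xi$ with respect to the $z$-axis is $\mathcal K=-\det(\xi,\dot\xi,(0,0,1))=\dot x\,y-x\,\dot y=-\dot\lambda\cos^2\varphi$, considered as a function $\mathcal K(z)$ of the coordinate $z$. Spherical catenaries are described in cylindrical coordinates $(r,\theta,z)$, $r^2+z^2=1$, by $(z-z_0)\,r^2\,\frac{d\theta}{ds}=\text{constant}$; those considered here have $z_0=0$, $\theta=\lambda$ and constant $a$. *)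

(* Defs.v *)
From Stdlib Require Import Reals.
From Coquelicot Require Import Coquelicot.
Open Scope R_scope.

Definition R3 : Type := (R * R * R)%type.
Definition xc (p : R3) : R := fst (fst p).
Definition yc (p : R3) : R := snd (fst p).
Definition zc (p : R3) : R := snd p.

Definition det3 (u v w : R3) : R :=
  xc u * (yc v * zc w - zc v * yc w)
  - yc u * (xc v * zc w - zc v * xc w)
  + zc u * (xc v * yc w - yc v * xc w).

Definition velocity (xi : R -> R3) (s : R) : R3 :=
  (Derive (fun t => xc (xi t)) s,
   Derive (fun t => yc (xi t)) s,
   Derive (fun t => zc (xi t)) s).

Definition acceleration (xi : R -> R3) : R -> R3 := velocity (velocity xi).

(* The open interval ]l, r[, with possibly infinite endpoints. *)
Definition in_interval (l r : Rbar) (s : R) : Prop := Rbar_lt l s /\ Rbar_lt s r.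

(* [Derive] is total, so the existence of each derivative is required
   separately. *)
Definition C2_at (f : R -> R) (s : R) : Prop :=
  ex_derive f s /\ ex_derive (Derive f) s /\ continuous (Derive (Derive f)) s.

(* A C^2 curve in the unit sphere, parametrized by arc length on ]l, r[; its
   values outside ]l, r[ are irrelevant. *)
Definition spherical_curve (l r : Rbar) (xi : R -> R3) : Prop :=
  forall s, in_interval l r s ->
    C2_at (fun t => xc (xi t)) s /\
    C2_at (fun t => yc (xi t)) s /\
    C2_at (fun t => zc (xi t)) s /\
    xc (xi s) ^ 2 + yc (xi s) ^ 2 + zc (xi s) ^ 2 = 1 /\
    xc (velocity xi s) ^ 2 + yc (velocity xi s) ^ 2 + zc (velocity xi s) ^ 2 = 1.

Definition nonconstant_z (l r : Rbar) (xi : R -> R3) : Prop :=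
  exists s t, in_interval l r s /\ in_interval l r t /\ zc (xi s) <> zc (xi t).

Definition geodesic_curvature (xi : R -> R3) (s : R) : R :=
  det3 (xi s) (velocity xi s) (acceleration xi s).

Definition angular_momentum (xi : R -> R3) (s : R) : R :=
  - det3 (xi s) (velocity xi s) (0, 0, 1).

(* A quantity [q] along the curve is the function [F] of the coordinate z,
   where [F] has domain [D]; the curve is required to stay over [D]. *)
Definition is_function_of_z (l r : Rbar) (xi : R -> R3) (q : R -> R)
    (D : R -> Prop) (F : R -> R) : Prop :=
  forall s, in_interval l r s -> D (zc (xi s)) /\ q s = F (zc (xi s)).

(* [phi] is the latitude and [lam] a choice of longitude along the curve. *)
Definition geographical (l r : Rbar) (xi : R -> R3) (phi lam : R -> R) : Prop :=
  forall s, in_interval l r s ->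
    - PI / 2 <= phi s <= PI / 2 /\
    xi s = (cos (phi s) * cos (lam s), cos (phi s) * sin (lam s), sin (phi s)).

Definition cylindrical (l r : Rbar) (xi : R -> R3) (rho theta : R -> R) : Prop :=
  forall s, in_interval l r s ->
    0 <= rho s /\ rho s ^ 2 + zc (xi s) ^ 2 = 1 /\
    xc (xi s) = rho s * cos (theta s) /\ yc (xi s) = rho s * sin (theta s).

(* (z - z0) rho^2 dtheta/ds = c *)
Definition spherical_catenary (z0 c : R) (l r : Rbar) (xi : R -> R3) : Prop :=
  exists rho theta : R -> R, cylindrical l r xi rho theta /\
    forall s, in_interval l r s ->
      ex_derive theta s /\ (zc (xi s) - z0) * rho s ^ 2 * Derive theta s = c.

(* dlam = a / (z (1 - z^2)) ds *)
Definition catenary_longitude (a : R) (l r : Rbar) (xi : R -> R3) : Prop :=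
  exists phi lam : R -> R, geographical l r xi phi lam /\
    forall s, in_interval l r s ->
      zc (xi s) * (1 - zc (xi s) ^ 2) <> 0 /\
      is_derive lam s (a / (zc (xi s) * (1 - zc (xi s) ^ 2))).

Definition rotation_z (theta : R) (p : R3) : R3 :=
  (xc p * cos theta - yc p * sin theta,
   xc p * sin theta + yc p * cos theta,
   zc p).

(* Main.v *)
Require Import Defs.
From Stdlib Require Import Reals Ranalysis5 Lra Classical.
From Coquelicot Require Import Coquelicot.
Open Scope R_scope.

(* In the frame (xi, xi', xi x xi') one finds z'^2 = 1 - z^2 - K^2,
   z'' = - z - kappa K and K' = kappa z'.  If K = -a/z and z is not constant,
   this forces kappa = a/z^2, and w = z^2 - 1/2 satisfies w'' = -4 w and
   w'^2 + 4 w^2 = 1 - 4 a^2; hence z^2 = 1/2 + sqrt(1/4 - a^2) sin (2 s + d),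
   which determines z up to a shift of s and a sign.  The direction
   (x, y) / sqrt(1 - z^2) turns at the rate -K / (1 - z^2) = a / (z (1 - z^2)),
   which determines the longitude up to a constant. *)

(** The first-order equation for w alone does not determine the height: besides the sine waves it
    has the constant solutions w = c and w = -c with c^2 = 1/4 - a^2, and an arc of a wave can be
    glued to one of them at a turning point with a continuous w'. Only w'' detects such a gluing,
    since it would jump there. This is why the curvature is determined before the height: K' = kappa
    z' says nothing where z' = 0, and the continuity of kappa, the only regularity available for it
    on a C^2 curve, has to rule the gluing out. Afterwards no theorem on differential equations is
    invoked. The height and the longitude both reduce to a unit vector of the plane turning at a
    known rate, and such a vector is found by turning it back. The bound a < 1/2 makes the amplitude
    c positive, and a > 0 keeps z^2 strictly between 0 and 1, so that all divisions by z and 1 - z^2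
    are legitimate. *)

Ltac rewrite_derive H :=
  match type of H with
  | is_derive ?f ?s ?d =>
      let E := fresh in
      (* [auto_derive] leaves the derivative of an unknown function as [Derive] of an eta-expansion,
         so the equation is put in that form before rewriting. *)
      assert (E : Derive (fun t => f t) s = d)
        by exact (is_derive_unique f s d H);
      cbv beta in E; rewrite E; clear E
  end.

(** * Calculus on an open interval *)

Lemma is_derive_continuous (f : R -> R) (s d : R) :
  is_derive f s d -> continuous f s.
Proof. intros Hf; apply (ex_derive_continuous f); now exists d. Qed.

Lemma in_interval_convex (l r : Rbar) (s t u : R) :
  in_interval l r s -> in_interval l r t -> Rmin s t <= u <= Rmax s t ->
  in_interval l r u.
Proof.
  unfold in_interval, Rmin, Rmax; intros [Hs1 Hs2] [Ht1 Ht2] Hu.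
  destruct l, r; simpl in *; destruct (Rle_dec s t); split; trivial; lra.
Qed.

Lemma in_interval_locally (l r : Rbar) (s : R) :
  in_interval l r s -> locally s (in_interval l r).
Proof.
  intros [H1 H2]; apply filter_and.
  - exact (open_Rbar_gt l s H1).
  - exact (open_Rbar_lt r s H2).
Qed.

Lemma derive_zero_constant (l r : Rbar) (f : R -> R) (s t : R) :
  (forall u, in_interval l r u -> is_derive f u 0) ->
  in_interval l r s -> in_interval l r t -> f s = f t.
Proof.
  intros Hf Hs Ht.
  destruct (MVT_gen f t s (fun _ => 0)) as [c [_ Hc]].
  - intros u Hu; apply Hf, (in_interval_convex l r t s); trivial; lra.
  - intros u Hu; apply continuity_pt_filterlim.
    apply (ex_derive_continuous f u); exists 0.
    now apply Hf, (in_interval_convex l r t s).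
  - lra.
Qed.

Lemma continuous_nonzero_same_sign (l r : Rbar) (f : R -> R) (s t : R) :
  (forall u, in_interval l r u -> continuous f u) ->
  (forall u, in_interval l r u -> f u <> 0) ->
  in_interval l r s -> in_interval l r t -> 0 < f s -> 0 < f t.
Proof.
  intros Cf Nf Hs Ht Ps; apply Rnot_le_lt; intros Pt.
  assert (Pt' : f t < 0) by (specialize (Nf t Ht); lra).
  assert (Cv : forall u, Rmin s t <= u <= Rmax s t -> in_interval l r u)
    by (intros u; now apply in_interval_convex).
  destruct (Rtotal_order s t) as [Hst | [-> | Hst]]; [ | lra | ].
  - rewrite Rmin_left, Rmax_right in Cv by lra.
    destruct (IVT_interv (fun u => - f u) s t) as [u [Hu Zu]]; try lra.
    + intros u Hu; apply continuity_pt_filterlim.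
      now apply (continuous_opp f u), Cf, Cv.
    + apply (Nf u); [now apply Cv | lra].
  - rewrite Rmin_right, Rmax_left in Cv by lra.
    destruct (IVT_interv f t s) as [u [Hu Zu]]; try lra.
    + intros u Hu; apply continuity_pt_filterlim; now apply Cf, Cv.
    + now apply (Nf u); [apply Cv | ].
Qed.

Lemma is_derive_RInt_interval (l r : Rbar) (g : R -> R) (t s : R) :
  (forall u, in_interval l r u -> continuous g u) ->
  in_interval l r t -> in_interval l r s ->
  is_derive (fun u => RInt g t u) s (g s).
Proof.
  intros Cg Ht Hs; apply is_derive_RInt with t; [ | now apply Cg].
  apply filter_imp with (2 := in_interval_locally l r s Hs).
  intros u Hu; apply (RInt_correct g), (ex_RInt_continuous g).
  intros v Hv; apply Cg; now apply (in_interval_convex l r t u).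
Qed.

Lemma unit_circle_angle (p q : R) :
  p ^ 2 + q ^ 2 = 1 -> exists d, p = cos d /\ q = sin d.
Proof.
  intros H.
  assert (Hp : -1 <= p <= 1) by nra.
  assert (Hs : sin (acos p) = Rabs q).
  { rewrite sin_acos by trivial.
    rewrite <- sqrt_Rsqr_abs; f_equal; unfold Rsqr; nra. }
  destruct (Rle_dec 0 q) as [Hq | Hq].
  - exists (acos p); rewrite Hs, cos_acos, Rabs_pos_eq; auto.
  - exists (- acos p); rewrite cos_neg, sin_neg, Hs, cos_acos, Rabs_left by lra.
    split; lra.
Qed.

(** Turning (p, q) back through the angle L gives a vector (A, B) with zero derivative, hence a
    fixed point of the unit circle. The height uses this with the constant rate 2, the longitude
    with the rate a / (z (1 - z^2)). *)
Lemma rotation_angle (l r : Rbar) (p q mu L : R -> R) (t : R) :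
  in_interval l r t -> p t ^ 2 + q t ^ 2 = 1 ->
  (forall s, in_interval l r s ->
     is_derive p s (- mu s * q s) /\ is_derive q s (mu s * p s) /\
     is_derive L s (mu s)) ->
  exists d, forall s, in_interval l r s ->
    p s = cos (L s + d) /\ q s = sin (L s + d).
Proof.
  intros Ht H1 HD.
  pose (A s := p s * cos (L s) + q s * sin (L s)).
  pose (B s := q s * cos (L s) - p s * sin (L s)).
  assert (DA : forall s, in_interval l r s -> is_derive A s 0).
  { intros s Hs; destruct (HD s Hs) as (Hp & Hq & HL); unfold A.
    auto_derive; [repeat split; eexists; eassumption | ].
    rewrite_derive Hp; rewrite_derive Hq; rewrite_derive HL; ring. }
  assert (DB : forall s, in_interval l r s -> is_derive B s 0).
  { intros s Hs; destruct (HD s Hs) as (Hp & Hq & HL); unfold B.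
    auto_derive; [repeat split; eexists; eassumption | ].
    rewrite_derive Hp; rewrite_derive Hq; rewrite_derive HL; ring. }
  assert (T1 : forall s, cos (L s) ^ 2 + sin (L s) ^ 2 = 1).
  { intros s; generalize (sin2_cos2 (L s)); unfold Rsqr; lra. }
  destruct (unit_circle_angle (A t) (B t)) as [d [Ad Bd]].
  { replace (A t ^ 2 + B t ^ 2)
      with ((p t ^ 2 + q t ^ 2) * (cos (L t) ^ 2 + sin (L t) ^ 2))
      by (unfold A, B; ring).
    rewrite H1, T1; ring. }
  exists d; intros s Hs.
  rewrite cos_plus, sin_plus, <- Ad, <- Bd.
  rewrite (derive_zero_constant l r A t s), (derive_zero_constant l r B t s)
    by trivial.
  split.
  - replace (p s) with (p s * (cos (L s) ^ 2 + sin (L s) ^ 2)) at 1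
      by (rewrite T1; ring).
    unfold A, B; ring.
  - replace (q s) with (q s * (cos (L s) ^ 2 + sin (L s) ^ 2)) at 1
      by (rewrite T1; ring).
    unfold A, B; ring.
Qed.

Lemma is_derive_Rmult (f g : R -> R) (s df dg : R) :
  is_derive f s df -> is_derive g s dg ->
  is_derive (fun t => f t * g t) s (df * g s + f s * dg).
Proof. intros Hf Hg; exact (is_derive_mult f g s df dg Hf Hg Rmult_comm). Qed.

(** * The moving frame of a spherical curve *)

Definition dot3 (u v : R3) : R := xc u * xc v + yc u * yc v + zc u * zc v.

Lemma spherical_curve_derive (l r : Rbar) (xi : R -> R3) (s : R) :
  spherical_curve l r xi -> in_interval l r s ->
  is_derive (fun t => xc (xi t)) s (xc (velocity xi s)) /\
  is_derive (fun t => yc (xi t)) s (yc (velocity xi s)) /\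
  is_derive (fun t => zc (xi t)) s (zc (velocity xi s)).
Proof.
  intros Hxi Hs; destruct (Hxi s Hs) as ((Hx & _) & (Hy & _) & (Hz & _) & _).
  repeat split; now apply Derive_correct.
Qed.

Lemma spherical_curve_derive2 (l r : Rbar) (xi : R -> R3) (s : R) :
  spherical_curve l r xi -> in_interval l r s ->
  is_derive (fun t => xc (velocity xi t)) s (xc (acceleration xi s)) /\
  is_derive (fun t => yc (velocity xi t)) s (yc (acceleration xi s)) /\
  is_derive (fun t => zc (velocity xi t)) s (zc (acceleration xi s)).
Proof.
  intros Hxi Hs.
  destruct (Hxi s Hs) as ((_ & Hx & _) & (_ & Hy & _) & (_ & Hz & _) & _).
  split; [ | split].
  - exact (Derive_correct _ _ Hx).
  - exact (Derive_correct _ _ Hy).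
  - exact (Derive_correct _ _ Hz).
Qed.

Lemma is_derive_dot3 (u v u' v' : R -> R3) (s : R) :
  is_derive (fun t => xc (u t)) s (xc (u' s)) ->
  is_derive (fun t => yc (u t)) s (yc (u' s)) ->
  is_derive (fun t => zc (u t)) s (zc (u' s)) ->
  is_derive (fun t => xc (v t)) s (xc (v' s)) ->
  is_derive (fun t => yc (v t)) s (yc (v' s)) ->
  is_derive (fun t => zc (v t)) s (zc (v' s)) ->
  is_derive (fun t => dot3 (u t) (v t)) s (dot3 (u' s) (v s) + dot3 (u s) (v' s)).
Proof.
  intros Hx Hy Hz Kx Ky Kz; unfold dot3.
  evar_last.
  - apply (is_derive_plus (V := R_NormedModule));
      [apply (is_derive_plus (V := R_NormedModule)) | ];
      apply is_derive_Rmult; eassumption.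
  - unfold plus; simpl; ring.
Qed.

Lemma is_derive_locally_constant (l r : Rbar) (f : R -> R) (c d s : R) :
  (forall t, in_interval l r t -> f t = c) -> in_interval l r s ->
  is_derive f s d -> d = 0.
Proof.
  intros Hf Hs Hd; rewrite <- (is_derive_unique _ _ _ Hd).
  apply is_derive_unique, (is_derive_ext_loc (fun _ => c)).
  - apply filter_imp with (2 := in_interval_locally l r s Hs).
    intros t Ht; now rewrite Hf.
  - apply (is_derive_const c).
Qed.

Lemma spherical_curve_frame (l r : Rbar) (xi : R -> R3) (s : R) :
  spherical_curve l r xi -> in_interval l r s ->
  dot3 (xi s) (xi s) = 1 /\ dot3 (velocity xi s) (velocity xi s) = 1 /\
  dot3 (xi s) (velocity xi s) = 0 /\
  dot3 (velocity xi s) (acceleration xi s) = 0 /\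
  dot3 (xi s) (acceleration xi s) = -1.
Proof.
  intros Hxi Hs.
  assert (U : forall t, in_interval l r t -> dot3 (xi t) (xi t) = 1).
  { intros t Ht; destruct (Hxi t Ht) as (_ & _ & _ & H & _); unfold dot3; lra. }
  assert (V : forall t, in_interval l r t ->
    dot3 (velocity xi t) (velocity xi t) = 1).
  { intros t Ht; destruct (Hxi t Ht) as (_ & _ & _ & _ & H); unfold dot3; lra. }
  assert (D : forall t, in_interval l r t -> dot3 (xi t) (velocity xi t) = 0).
  { intros t Ht.
    destruct (spherical_curve_derive l r xi t Hxi Ht) as (Hx & Hy & Hz).
    generalize (is_derive_locally_constant l r _ 1 _ t U Ht
      (is_derive_dot3 xi xi _ _ t Hx Hy Hz Hx Hy Hz)).
    unfold dot3; lra. }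
  destruct (spherical_curve_derive l r xi s Hxi Hs) as (Hx & Hy & Hz).
  destruct (spherical_curve_derive2 l r xi s Hxi Hs) as (Kx & Ky & Kz).
  assert (VA := is_derive_locally_constant l r _ 1 _ s V Hs
    (is_derive_dot3 _ _ _ _ s Kx Ky Kz Kx Ky Kz)).
  assert (UA := is_derive_locally_constant l r _ 0 _ s D Hs
    (is_derive_dot3 _ _ _ _ s Hx Hy Hz Kx Ky Kz)).
  specialize (U s Hs); specialize (V s Hs); specialize (D s Hs).
  repeat split; trivial; unfold dot3 in *; lra.
Qed.

(* The product of the determinants of (u, v, w) and (u, v, k), with k the
   vertical unit vector, is a Gram determinant. *)
Lemma det3_gram_vertical (u v w : R3) :
  dot3 u u = 1 -> dot3 v v = 1 -> dot3 u v = 0 -> dot3 v w = 0 ->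
  det3 u v w * det3 u v (0, 0, 1) = zc w - dot3 u w * zc u.
Proof.
  intros Huu Hvv Huv Hvw.
  transitivity
    (dot3 u u * (dot3 v v * zc w - dot3 v w * zc v)
     - dot3 u v * (dot3 u v * zc w - dot3 u w * zc v)
     + zc u * (dot3 u v * dot3 v w - dot3 v v * dot3 u w)).
  - destruct u as [[? ?] ?], v as [[? ?] ?], w as [[? ?] ?].
    unfold det3, dot3, xc, yc, zc; simpl; ring.
  - rewrite Huu, Hvv, Huv, Hvw; ring.
Qed.

(** This is the vertical component of xi'' = - xi + kappa (xi x xi'), because the vertical component
    of xi x xi' is -K. *)
Lemma zc_acceleration (l r : Rbar) (xi : R -> R3) (s : R) :
  spherical_curve l r xi -> in_interval l r s ->
  zc (acceleration xi s)
  = - zc (xi s) - geodesic_curvature xi s * angular_momentum xi s.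
Proof.
  intros Hxi Hs.
  destruct (spherical_curve_frame l r xi s Hxi Hs) as (UU & VV & UV & VA & UA).
  generalize (det3_gram_vertical _ _ _ UU VV UV VA).
  rewrite UA; unfold angular_momentum, geodesic_curvature; lra.
Qed.

(** The vertical unit vector has coordinates z, z', -K in the orthonormal frame, and their squares
    add up to 1. The computation uses Lagrange's identity for the horizontal parts of xi and xi'. *)
Lemma zc_velocity_sqr (l r : Rbar) (xi : R -> R3) (s : R) :
  spherical_curve l r xi -> in_interval l r s ->
  zc (velocity xi s) ^ 2
  = 1 - zc (xi s) ^ 2 - angular_momentum xi s ^ 2.
Proof.
  intros Hxi Hs.
  destruct (spherical_curve_frame l r xi s Hxi Hs) as (UU & VV & UV & _).
  unfold angular_momentum.
  generalize dependent (velocity xi s); generalize dependent (xi s).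
  intros [[x y] z] UU [[x' y'] z'].
  unfold det3, dot3, xc, yc, zc in *; simpl in *; intros VV UV.
  assert (E1 : x * x + y * y = 1 - z * z) by lra.
  assert (E2 : x' * x' + y' * y' = 1 - z' * z') by lra.
  assert (E3 : x * x' + y * y' = - z * z') by lra.
  assert (E : (x * y' - y * x') ^ 2 =
    (x * x + y * y) * (x' * x' + y' * y') - (x * x' + y * y') ^ 2) by ring.
  rewrite E1, E2, E3 in E; lra.
Qed.

Lemma is_derive_angular_momentum (l r : Rbar) (xi : R -> R3) (s : R) :
  spherical_curve l r xi -> in_interval l r s ->
  is_derive (angular_momentum xi) s
    (geodesic_curvature xi s * zc (velocity xi s)).
Proof.
  intros Hxi Hs.
  destruct (spherical_curve_derive l r xi s Hxi Hs) as (Hx & Hy & _).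
  destruct (spherical_curve_derive2 l r xi s Hxi Hs) as (Kx & Ky & _).
  destruct (spherical_curve_frame l r xi s Hxi Hs) as (_ & VV & UV & VA & _).
  apply (is_derive_ext (fun t => xc (velocity xi t) * yc (xi t)
                               - xc (xi t) * yc (velocity xi t))).
  { intros t; unfold angular_momentum, det3; simpl; unfold xc, yc, zc; simpl.
    ring. }
  evar_last.
  { apply (is_derive_minus (V := R_NormedModule)); apply is_derive_Rmult;
      eassumption. }
  unfold geodesic_curvature.
  generalize dependent (acceleration xi s); generalize dependent (velocity xi s).
  generalize (xi s); intros u v _ _ VV UV w _ _ VA.
  unfold minus, plus, opp; simpl.
  (* Vertical component of the identity det(u, v, w) p = (p.u) v x w + (p.v) w x u + (p.w) u x v at
     p = v; orthonormality leaves only the term with v.v. *)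
  transitivity (dot3 v v * (xc w * yc u - yc w * xc u)
    + dot3 u v * (xc v * yc w - yc v * xc w)
    + dot3 v w * (xc u * yc v - yc u * xc v)).
  - rewrite VV, UV, VA; ring.
  - destruct u as [[? ?] ?], v as [[? ?] ?], w as [[? ?] ?].
    unfold det3, dot3, xc, yc, zc; simpl; ring.
Qed.

(** This continuity is what carries kappa = a/z^2 across the points where z' = 0. *)
Lemma continuous_geodesic_curvature (l r : Rbar) (xi : R -> R3) (s : R) :
  spherical_curve l r xi -> in_interval l r s ->
  continuous (geodesic_curvature xi) s.
Proof.
  intros Hxi Hs.
  destruct (spherical_curve_derive l r xi s Hxi Hs) as (Hx & Hy & Hz).
  destruct (spherical_curve_derive2 l r xi s Hxi Hs) as (Kx & Ky & Kz).
  destruct (Hxi s Hs) as ((_ & _ & Cx) & (_ & _ & Cy) & (_ & _ & Cz) & _).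
  apply is_derive_continuous in Hx, Hy, Hz, Kx, Ky, Kz.
  unfold geodesic_curvature, det3.
  assert (M : forall f g : R -> R, continuous f s -> continuous g s ->
    continuous (fun t => f t * g t) s)
    by (intros f g; apply (continuous_mult (K := R_AbsRing))).
  assert (N : forall f g : R -> R, continuous f s -> continuous g s ->
    continuous (fun t => f t - g t) s)
    by (intros f g; apply (continuous_minus (V := R_NormedModule))).
  apply (continuous_plus (V := R_NormedModule)); [apply N | ];
    apply M; trivial; apply N; apply M; trivial; assumption.
Qed.

(** * Angular momentum in polar coordinates *)

Lemma angular_momentum_eq (xi : R -> R3) (s : R) :
  angular_momentum xi s
  = xc (velocity xi s) * yc (xi s) - xc (xi s) * yc (velocity xi s).
Proof.
  unfold angular_momentum, det3.
  generalize (velocity xi s) (xi s); intros u v.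
  unfold xc, yc, zc; simpl; ring.
Qed.

Lemma is_derive_unique2 (l r : Rbar) (f g : R -> R) (s df dg : R) :
  (forall t, in_interval l r t -> f t = g t) -> in_interval l r s ->
  is_derive f s df -> is_derive g s dg -> df = dg.
Proof.
  intros E Hs Hf Hg.
  rewrite <- (is_derive_unique _ _ _ Hf), <- (is_derive_unique _ _ _ Hg).
  apply Derive_ext_loc, filter_imp with (2 := in_interval_locally l r s Hs).
  exact E.
Qed.

(** Twice the areal velocity: the radial derivative cancels, so the momentum is read off the radius
    and the angular rate. *)
Lemma polar_areal_velocity (l r : Rbar) (x y rho theta : R -> R)
    (s dx dy dtheta : R) :
  in_interval l r s ->
  (forall t, in_interval l r t ->
     x t = rho t * cos (theta t) /\ y t = rho t * sin (theta t)) ->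
  is_derive x s dx -> is_derive y s dy -> is_derive theta s dtheta ->
  x s * dy - y s * dx = rho s ^ 2 * dtheta.
Proof.
  intros Hs E Hx Hy Ht.
  assert (T1 : forall t, cos (theta t) ^ 2 + sin (theta t) ^ 2 = 1).
  { intros t; generalize (sin2_cos2 (theta t)); unfold Rsqr; lra. }
  (* [rho] is not assumed differentiable, but equals [m] on the interval. *)
  set (m t := x t * cos (theta t) + y t * sin (theta t)).
  assert (Em : forall t, in_interval l r t -> m t = rho t).
  { intros t It; unfold m; destruct (E t It) as [-> ->].
    transitivity (rho t * (cos (theta t) ^ 2 + sin (theta t) ^ 2));
      [ring | rewrite T1; ring]. }
  assert (Hm : exists dm, is_derive m s dm).
  { eexists; unfold m; auto_derive;
      [repeat split; eexists; eassumption | reflexivity]. }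
  destruct Hm as [dm Hm].
  assert (Ex : dx = dm * cos (theta s) - rho s * sin (theta s) * dtheta).
  { apply (is_derive_unique2 l r x (fun t => m t * cos (theta t)) s); trivial.
    - intros t It; rewrite Em by trivial; now apply E.
    - auto_derive; [repeat split; eexists; eassumption | ].
      rewrite_derive Hm; rewrite_derive Ht; rewrite Em by trivial; ring. }
  assert (Ey : dy = dm * sin (theta s) + rho s * cos (theta s) * dtheta).
  { apply (is_derive_unique2 l r y (fun t => m t * sin (theta t)) s); trivial.
    - intros t It; rewrite Em by trivial; now apply E.
    - auto_derive; [repeat split; eexists; eassumption | ].
      rewrite_derive Hm; rewrite_derive Ht; rewrite Em by trivial; ring. }
  destruct (E s Hs) as [-> ->]; rewrite Ex, Ey.
  transitivity (rho s ^ 2 * dtheta * (cos (theta s) ^ 2 + sin (theta s) ^ 2));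
    [ring | rewrite T1; ring].
Qed.

Lemma angular_momentum_polar (l r : Rbar) (xi : R -> R3) (rho theta : R -> R)
    (s dtheta : R) :
  spherical_curve l r xi -> in_interval l r s ->
  (forall t, in_interval l r t ->
     xc (xi t) = rho t * cos (theta t) /\ yc (xi t) = rho t * sin (theta t)) ->
  is_derive theta s dtheta ->
  angular_momentum xi s = - (rho s ^ 2 * dtheta).
Proof.
  intros Hxi Hs E Ht.
  destruct (spherical_curve_derive l r xi s Hxi Hs) as (Hx & Hy & _).
  rewrite <- (polar_areal_velocity l r _ _ rho theta s _ _ _ Hs E Hx Hy Ht).
  rewrite angular_momentum_eq; ring.
Qed.

Lemma is_derive_div_horizontal_radius (x z : R -> R) (s dx dz : R) :
  z s ^ 2 < 1 -> is_derive x s dx -> is_derive z s dz ->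
  is_derive (fun t => x t / sqrt (1 - z t ^ 2)) s
    ((dx * (1 - z s ^ 2) + x s * (z s * dz))
     / ((1 - z s ^ 2) * sqrt (1 - z s ^ 2))).
Proof.
  intros Hz Hx Hdz.
  assert (P : 0 < sqrt (1 - z s ^ 2)) by (apply sqrt_lt_R0; lra).
  assert (Q : sqrt (1 - z s ^ 2) * sqrt (1 - z s ^ 2) = 1 - z s ^ 2)
    by (apply sqrt_sqrt; lra).
  (* The shape that 1 - z^2 takes in the output of [auto_derive], so that [P] and [Q] match it. *)
  replace (1 - z s ^ 2) with (1 + - (z s * (z s * 1))) in * by ring.
  auto_derive.
  - repeat split; try (eexists; eassumption); lra.
  - rewrite_derive Hx; rewrite_derive Hdz.
    set (q := sqrt _) in *; rewrite <- Q; field; lra.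
Qed.

Lemma horizontal_direction_rotates (l r : Rbar) (xi : R -> R3) (s : R) :
  spherical_curve l r xi -> in_interval l r s -> zc (xi s) ^ 2 < 1 ->
  let R t := sqrt (1 - zc (xi t) ^ 2) in
  let mu := - angular_momentum xi s / (1 - zc (xi s) ^ 2) in
  is_derive (fun t => xc (xi t) / R t) s (- mu * (yc (xi s) / R s)) /\
  is_derive (fun t => yc (xi t) / R t) s (mu * (xc (xi s) / R s)).
Proof.
  intros Hxi Hs Hz R mu.
  destruct (spherical_curve_derive l r xi s Hxi Hs) as (Hx & Hy & Hdz).
  destruct (spherical_curve_frame l r xi s Hxi Hs) as (UU & _ & UV & _).
  assert (P : 0 < R s) by (apply sqrt_lt_R0; lra).
  unfold dot3 in UU, UV.
  (* The sphere and tangency equations eliminate z and z'; what remains is a rational identity in x,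
     y, x', y' and the radius. *)
  assert (E1 : 1 - zc (xi s) ^ 2 = xc (xi s) ^ 2 + yc (xi s) ^ 2) by lra.
  assert (E2 : zc (xi s) * zc (velocity xi s) =
    - (xc (xi s) * xc (velocity xi s)) - yc (xi s) * yc (velocity xi s)) by lra.
  unfold mu; rewrite angular_momentum_eq.
  split; (evar_last; [now apply is_derive_div_horizontal_radius; eassumption | ]);
    cbv beta; fold (R s); rewrite E2, E1; field; split; lra.
Qed.

(** * Consequences of the momentum law K = -a/z *)

Lemma momentum_zc_velocity_sqr (a : R) (l r : Rbar) (xi : R -> R3) (s : R) :
  spherical_curve l r xi -> in_interval l r s -> zc (xi s) <> 0 ->
  angular_momentum xi s = - a / zc (xi s) ->
  zc (velocity xi s) ^ 2 = 1 - zc (xi s) ^ 2 - a ^ 2 / zc (xi s) ^ 2.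
Proof.
  intros Hxi Hs Nz HK.
  rewrite (zc_velocity_sqr l r xi s Hxi Hs), HK; now field.
Qed.

(** The curve cannot reach the poles, because 1 - z^2 = z'^2 + a^2/z^2 is positive. *)
Lemma momentum_zc_sqr_lt_1 (a : R) (l r : Rbar) (xi : R -> R3) (s : R) :
  a <> 0 ->
  spherical_curve l r xi -> in_interval l r s -> zc (xi s) <> 0 ->
  angular_momentum xi s = - a / zc (xi s) -> zc (xi s) ^ 2 < 1.
Proof.
  intros Na Hxi Hs Nz HK.
  generalize (momentum_zc_velocity_sqr a l r xi s Hxi Hs Nz HK).
  assert (0 < a ^ 2 / zc (xi s) ^ 2)
    by (apply Rdiv_lt_0_compat; apply pow2_gt_0; trivial).
  generalize (pow2_ge_0 (zc (velocity xi s))); lra.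
Qed.

(** [L] is an arbitrary primitive of the angular rate: an integral along [xi] when a longitude has
    to be produced, the shifted longitude of the complete catenary when two curves are compared. *)
Lemma momentum_longitude (a : R) (l r : Rbar) (xi : R -> R3) (L : R -> R)
    (t : R) :
  a <> 0 -> spherical_curve l r xi -> in_interval l r t ->
  is_function_of_z l r xi (angular_momentum xi)
    (fun z => z <> 0) (fun z => - a / z) ->
  (forall s, in_interval l r s ->
     is_derive L s (a / (zc (xi s) * (1 - zc (xi s) ^ 2)))) ->
  exists d, forall s, in_interval l r s ->
    xc (xi s) = sqrt (1 - zc (xi s) ^ 2) * cos (L s + d) /\
    yc (xi s) = sqrt (1 - zc (xi s) ^ 2) * sin (L s + d).
Proof.
  intros Na Hxi It HK HL.
  assert (Z1 : forall s, in_interval l r s -> zc (xi s) ^ 2 < 1).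
  { intros s Is; destruct (HK s Is); now apply (momentum_zc_sqr_lt_1 a l r). }
  pose (R s := sqrt (1 - zc (xi s) ^ 2)).
  assert (P : forall s, in_interval l r s -> 0 < R s).
  { intros s Is; apply sqrt_lt_R0; specialize (Z1 s Is); lra. }
  destruct (rotation_angle l r (fun s => xc (xi s) / R s)
    (fun s => yc (xi s) / R s)
    (fun s => a / (zc (xi s) * (1 - zc (xi s) ^ 2))) L t It) as [d Hd].
  - specialize (Z1 t It); specialize (P t It).
    destruct (spherical_curve_frame l r xi t Hxi It) as (UU & _).
    unfold dot3 in UU.
    assert (Q : R t * R t = 1 - zc (xi t) ^ 2) by (apply sqrt_sqrt; lra).
    transitivity ((xc (xi t) ^ 2 + yc (xi t) ^ 2) / (R t * R t));
      [field; lra | ].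
    rewrite Q; replace (xc (xi t) ^ 2 + yc (xi t) ^ 2)
      with (1 - zc (xi t) ^ 2) by lra; field; lra.
  - intros s Is; specialize (Z1 s Is); destruct (HK s Is) as [Nz Ks].
    destruct (horizontal_direction_rotates l r xi s Hxi Is Z1) as [Dx Dy].
    rewrite Ks in Dx, Dy.
    replace (- (- a / zc (xi s)) / (1 - zc (xi s) ^ 2))
      with (a / (zc (xi s) * (1 - zc (xi s) ^ 2))) in Dx, Dy
      by (field; split; trivial; lra).
    split; [exact Dx | split; [exact Dy | now apply HL]].
  - exists d; intros s Is; specialize (P s Is).
    destruct (Hd s Is) as [<- <-]; fold (R s); split; field; lra.
Qed.

Lemma is_derive_longitude_rate (a : R) (z : R -> R) (s dz : R) :
  z s <> 0 -> z s ^ 2 < 1 -> is_derive z s dz ->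
  is_derive (fun t => a / (z t * (1 - z t ^ 2))) s
    (- a * (1 - 3 * z s ^ 2) / (z s * (1 - z s ^ 2)) ^ 2 * dz).
Proof.
  intros Nz Z1 Hz.
  assert (N : z s * (1 - z s ^ 2) <> 0)
    by (apply Rmult_integral_contrapositive_currified; lra).
  auto_derive.
  - split; [now exists dz | split; [now exists dz | split; trivial]].
  - rewrite_derive Hz; field; split; [lra | trivial].
Qed.

Lemma momentum_catenary_longitude (a : R) (l r : Rbar) (xi : R -> R3) (t : R) :
  a <> 0 -> spherical_curve l r xi -> in_interval l r t ->
  is_function_of_z l r xi (angular_momentum xi)
    (fun z => z <> 0) (fun z => - a / z) ->
  catenary_longitude a l r xi.
Proof.
  intros Na Hxi It HK.
  assert (Z1 : forall s, in_interval l r s -> zc (xi s) ^ 2 < 1).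
  { intros s Is; destruct (HK s Is); now apply (momentum_zc_sqr_lt_1 a l r). }
  pose (g s := a / (zc (xi s) * (1 - zc (xi s) ^ 2))).
  assert (Cg : forall s, in_interval l r s -> continuous g s).
  { intros s Is; apply (ex_derive_continuous g); unfold g.
    destruct (HK s Is) as [Nz _]; specialize (Z1 s Is).
    destruct (spherical_curve_derive l r xi s Hxi Is) as (_ & _ & Hz).
    eexists; exact (is_derive_longitude_rate a _ s _ Nz Z1 Hz). }
  (* Integrating the rate yields a differentiable longitude on the whole interval, which a pointwise
     choice of angle would not. *)
  pose (L s := RInt g t s).
  assert (HL : forall s, in_interval l r s -> is_derive L s (g s))
    by (intros s Is; now apply (is_derive_RInt_interval l r)).
  destruct (momentum_longitude a l r xi L t Na Hxi It HK HL) as [d Hd].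
  (* The latitude [asin z] has nonnegative cosine, equal to the horizontal radius sqrt(1 - z^2). *)
  exists (fun s => asin (zc (xi s))), (fun s => L s + d).
  split; intros s Is; specialize (Z1 s Is).
  - split; [generalize (asin_bound (zc (xi s))); lra | ].
    rewrite cos_asin, sin_asin by nra.
    replace (1 - Rsqr (zc (xi s))) with (1 - zc (xi s) ^ 2)
      by (unfold Rsqr; ring).
    destruct (Hd s Is) as [<- <-]; now destruct (xi s) as [[? ?] ?].
  - split.
    + apply Rmult_integral_contrapositive_currified; [now apply HK | lra].
    + evar_last; [apply (is_derive_plus L (fun _ => d)) | ].
      * now apply HL.
      * apply (is_derive_const d).
      * apply plus_zero_r.
Qed.

Lemma catenary_longitude_momentum (a : R) (l r : Rbar) (xi : R -> R3) :
  spherical_curve l r xi -> catenary_longitude a l r xi ->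
  is_function_of_z l r xi (angular_momentum xi)
    (fun z => z <> 0) (fun z => - a / z).
Proof.
  intros Hxi (phi & lam & G & HL) s Is.
  destruct (HL s Is) as [N D].
  assert (Nz : zc (xi s) <> 0) by (intros E; apply N; rewrite E; ring).
  assert (N1 : 1 - zc (xi s) ^ 2 <> 0) by (intros E; apply N; rewrite E; ring).
  split; trivial.
  rewrite (angular_momentum_polar l r xi (fun u => cos (phi u)) lam s _ Hxi Is)
    with (2 := D).
  - destruct (G s Is) as [_ E].
    replace (cos (phi s) ^ 2) with (1 - zc (xi s) ^ 2); [now field; split | ].
    rewrite E; unfold zc; simpl.
    generalize (sin2_cos2 (phi s)); unfold Rsqr; lra.
  - intros u Iu; destruct (G u Iu) as [_ ->]; now split.
Qed.

Lemma catenary_longitude_spherical_catenary (a : R) (l r : Rbar)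
    (xi : R -> R3) :
  catenary_longitude a l r xi -> spherical_catenary 0 a l r xi.
Proof.
  intros (phi & lam & G & HL).
  exists (fun s => cos (phi s)), lam; split; intros s Is.
  - destruct (G s Is) as [B ->]; unfold xc, yc, zc; simpl.
    repeat split.
    + apply cos_ge_0; lra.
    + generalize (sin2_cos2 (phi s)); unfold Rsqr; lra.
  - destruct (HL s Is) as [N D]; split; [now eexists; exact D | ].
    rewrite (is_derive_unique _ _ _ D); destruct (G s Is) as [_ E].
    replace (cos (phi s) ^ 2) with (1 - zc (xi s) ^ 2).
    + field; split; intros E0; apply N; rewrite E0; ring.
    + rewrite E; unfold zc; simpl.
      generalize (sin2_cos2 (phi s)); unfold Rsqr; lra.
Qed.

Lemma spherical_catenary_catenary_longitude (a : R) (l r : Rbar)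
    (xi : R -> R3) :
  a <> 0 -> spherical_catenary 0 a l r xi -> catenary_longitude a l r xi.
Proof.
  intros Na (rho & theta & C & HT).
  exists (fun s => asin (zc (xi s))), theta.
  split; intros s Is; destruct (C s Is) as (Pr & E & Ex & Ey).
  - split; [generalize (asin_bound (zc (xi s))); lra | ].
    rewrite cos_asin, sin_asin by nra.
    replace (1 - Rsqr (zc (xi s))) with (rho s ^ 2) by (unfold Rsqr; lra).
    rewrite sqrt_pow2, <- Ex, <- Ey by trivial.
    now destruct (xi s) as [[? ?] ?].
  - destruct (HT s Is) as [D Ea]; apply Derive_correct in D.
    rewrite Rminus_0_r in Ea.
    replace (rho s ^ 2) with (1 - zc (xi s) ^ 2) in Ea by lra.
    (* This factor times theta' is a, which is nonzero: the curve avoids the equator and the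
       poles. *)
    assert (N : zc (xi s) * (1 - zc (xi s) ^ 2) <> 0)
      by (intros E0; rewrite E0 in Ea; lra).
    split; trivial.
    replace (a / (zc (xi s) * (1 - zc (xi s) ^ 2))) with (Derive theta s); trivial.
    rewrite <- Ea; field; split; intros E0; apply N; rewrite E0; ring.
Qed.

(* Differentiating K = -a/z gives (kappa - a/z^2) z' = 0, so kappa can differ
   from a/z^2 only where z is locally constant; there z^4 - z^2 + a^2 = 0 and
   (a kappa - a^2/z^2)^2 = 1 - 4 a^2.  By continuity, that alternative either
   never occurs or holds on the whole interval, and then z is constant. *)
Lemma momentum_curvature (a : R) (l r : Rbar) (xi : R -> R3) (s : R) :
  0 < a < 1 / 2 -> spherical_curve l r xi -> nonconstant_z l r xi ->
  is_function_of_z l r xi (angular_momentum xi)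
    (fun z => z <> 0) (fun z => - a / z) ->
  in_interval l r s -> geodesic_curvature xi s = a / zc (xi s) ^ 2.
Proof.
  intros Ha Hxi NC HK Is0.
  pose (H t := a * geodesic_curvature xi t - a ^ 2 / zc (xi t) ^ 2).
  assert (Dinv : forall (z : R -> R) (t dz : R), z t <> 0 -> is_derive z t dz ->
    is_derive (fun u => - a / z u) t (a * dz / z t ^ 2) /\
    is_derive (fun u => a ^ 2 / z u ^ 2) t (- 2 * a ^ 2 * dz / z t ^ 3)).
  { intros z t dz Nz Hz; split.
    - auto_derive; [now split; [exists dz | ] | ].
      rewrite_derive Hz; now field.
    - auto_derive; [split; [now exists dz | split; trivial] | ].
      + now apply (pow_nonzero _ 2).
      + rewrite_derive Hz; now field. }
  assert (CH : forall t, in_interval l r t -> continuous H t).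
  { intros t It; destruct (HK t It) as [Nz _].
    apply (continuous_minus (V := R_NormedModule)).
    - apply (continuous_scal_r a (geodesic_curvature xi)).
      now apply (continuous_geodesic_curvature l r).
    - destruct (spherical_curve_derive l r xi t Hxi It) as (_ & _ & Hz).
      apply (ex_derive_continuous (fun u => a ^ 2 / zc (xi u) ^ 2)).
      eexists; now apply (Dinv (fun u => zc (xi u)) t _ Nz Hz). }
  assert (Hz1 : forall t, in_interval l r t -> H t * zc (velocity xi t) = 0).
  { intros t It; destruct (HK t It) as [Nz _].
    destruct (spherical_curve_derive l r xi t Hxi It) as (_ & _ & Hz).
    assert (E : geodesic_curvature xi t * zc (velocity xi t)
                = a * zc (velocity xi t) / zc (xi t) ^ 2).
    { apply (is_derive_unique2 l r (angular_momentum xi)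
        (fun u => - a / zc (xi u)) t); trivial.
      - intros u Iu; now apply HK.
      - now apply (is_derive_angular_momentum l r).
      - now apply (Dinv (fun u => zc (xi u)) t _ Nz Hz). }
    unfold H; rewrite Rmult_minus_distr_r, Rmult_assoc, E; now field. }
  assert (H2 : forall t, in_interval l r t -> H t = 0 \/ H t ^ 2 = 1 - 4 * a ^ 2).
  { intros t It; destruct (HK t It) as [Nz Kt].
    destruct (classic (locally t (fun u => zc (velocity xi u) = 0))) as [L | L].
    - right.
      assert (V := locally_singleton _ _ L).
      assert (A : zc (acceleration xi t) = 0).
      { destruct (spherical_curve_derive2 l r xi t Hxi It) as (_ & _ & D).
        rewrite <- (is_derive_unique _ _ _ D).
        rewrite (Derive_ext_loc _ (fun _ => 0)) by exact L.
        apply Derive_const. }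
      rewrite (zc_acceleration l r xi t Hxi It), Kt in A.
      assert (B := momentum_zc_velocity_sqr a l r xi t Hxi It Nz Kt).
      rewrite V in B.
      assert (Eq : a * geodesic_curvature xi t = zc (xi t) ^ 2).
      { transitivity (zc (xi t) *
          (- zc (xi t) - geodesic_curvature xi t * (- a / zc (xi t)))
          + zc (xi t) ^ 2); [now field | rewrite A; ring]. }
      unfold H; rewrite Eq.
      (* From z' = 0 comes z^2 = 1 - w, and from z'' = 0 comes a kappa = z^2. Hence H = 1 - 2 w and
         H^2 = 1 - 4 w (1 - w), where w (1 - w) = w z^2 = a^2. *)
      set (w := a ^ 2 / zc (xi t) ^ 2) in *.
      assert (W : w * zc (xi t) ^ 2 = a ^ 2) by (unfold w; now field).
      replace (zc (xi t) ^ 2) with (1 - w) in * by lra.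
      rewrite <- W; ring.
    (* If H were nonzero at t, it would be nonzero nearby, and H z' = 0 would make z' vanish near
       t. *)
    - left; apply NNPP; intros NH; apply L.
      assert (LH : locally t (fun u => H u <> 0)).
      { apply (CH t It (fun v => v <> 0)).
        now apply (open_neq 0). }
      generalize (filter_and _ _ LH (in_interval_locally l r t It)).
      apply filter_imp; intros u [Nu Iu].
      destruct (Rmult_integral _ _ (Hz1 u Iu)); tauto. }
  assert (H0 : H s = 0).
  { apply NNPP; intros Ns.
    assert (HN : forall t, in_interval l r t -> H t <> 0).
    { intros t It Et.
      (* H^2 takes only the values 0 and 1 - 4 a^2, which differ since a < 1/2. Being continuous, it
         cannot cross their midpoint. *)
      assert (0 < H t ^ 2 - (1 - 4 * a ^ 2) / 2); [ | rewrite Et in *; nra].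
      apply (continuous_nonzero_same_sign l r
        (fun u => H u ^ 2 - (1 - 4 * a ^ 2) / 2) s t); trivial.
      - intros u Iu.
        apply (continuous_minus (V := R_NormedModule));
          [ | apply continuous_const].
        apply (continuous_ext (fun v => H v * H v)); [intros; simpl; ring | ].
        apply (continuous_mult (K := R_AbsRing)); now apply CH.
      - intros u Iu E; destruct (H2 u Iu) as [Z | Z];
          rewrite Z in E; nra.
      - destruct (H2 s Is0) as [Z | Z]; [now destruct Ns | rewrite Z; nra]. }
    destruct NC as (u & v & Iu & Iv & N); apply N.
    apply (derive_zero_constant l r (fun w => zc (xi w))); trivial.
    intros w Iw; destruct (spherical_curve_derive l r xi w Hxi Iw) as (_ & _ & D).
    destruct (Rmult_integral _ _ (Hz1 w Iw)) as [Z | Z];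
      [now destruct (HN w Iw) | now rewrite <- Z]. }
  destruct (HK s Is0) as [Nz _].
  unfold H in H0; apply (Rmult_eq_reg_l a); [ | lra].
  transitivity (a ^ 2 / zc (xi s) ^ 2); [lra | now field].
Qed.

Lemma momentum_height (a : R) (l r : Rbar) (xi : R -> R3) :
  0 < a < 1 / 2 -> spherical_curve l r xi -> nonconstant_z l r xi ->
  is_function_of_z l r xi (angular_momentum xi)
    (fun z => z <> 0) (fun z => - a / z) ->
  exists d, forall s, in_interval l r s ->
    zc (xi s) ^ 2 = 1 / 2 + sqrt (1 / 4 - a ^ 2) * sin (2 * s + d).
Proof.
  intros Ha Hxi NC HK.
  set (c := sqrt (1 / 4 - a ^ 2)).
  assert (Pc : 0 < c) by (apply sqrt_lt_R0; nra).
  assert (Qc : c * c = 1 / 4 - a ^ 2) by (apply sqrt_sqrt; nra).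
  assert (NC' := NC); destruct NC' as (t & _ & It & _).
  (* The vector is (w'/2, w)/c with w = z^2 - 1/2, and c is the amplitude that makes it a unit
     vector. *)
  destruct (rotation_angle l r
    (fun s => zc (xi s) * zc (velocity xi s) / c)
    (fun s => (zc (xi s) ^ 2 - 1 / 2) / c)
    (fun _ => 2) (fun s => 2 * s) t It) as [d Hd].
  - destruct (HK t It) as [Nz Kt].
    assert (B := momentum_zc_velocity_sqr a l r xi t Hxi It Nz Kt).
    transitivity ((zc (xi t) ^ 2 * zc (velocity xi t) ^ 2
                   + (zc (xi t) ^ 2 - 1 / 2) ^ 2) / (c * c)); [field; lra | ].
    rewrite B, Qc; field; split; trivial; nra.
  - intros s Is; destruct (HK s Is) as [Nz Ks].
    assert (B := momentum_zc_velocity_sqr a l r xi s Hxi Is Nz Ks).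
    assert (A := zc_acceleration l r xi s Hxi Is).
    rewrite Ks, (momentum_curvature a l r xi s Ha Hxi NC HK Is) in A.
    destruct (spherical_curve_derive l r xi s Hxi Is) as (_ & _ & Dz).
    destruct (spherical_curve_derive2 l r xi s Hxi Is) as (_ & _ & Dv).
    (* Abstract z and v make [auto_derive] treat the height and its velocity as atoms. *)
    assert (D : forall z v : R -> R, is_derive z s (v s) ->
      is_derive v s (zc (acceleration xi s)) ->
      is_derive (fun u => z u * v u / c) s
        ((v s ^ 2 + z s * zc (acceleration xi s)) / c) /\
      is_derive (fun u => (z u ^ 2 - 1 / 2) / c) s (2 * (z s * v s / c))).
    { intros z v Hz Hv; split.
      - auto_derive; [repeat split; eexists; eassumption | ].
        rewrite_derive Hz; rewrite_derive Hv; field; lra.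
      - auto_derive; [repeat split; eexists; eassumption | ].
        rewrite_derive Hz; field; lra. }
    destruct (D (fun u => zc (xi u)) (fun u => zc (velocity xi u)) Dz Dv)
      as [Dp Dq].
    split; [ | split; [exact Dq | auto_derive; trivial; ring]].
    evar_last; [exact Dp | rewrite B, A; field; split; [lra | trivial]].
  - exists d; intros s Is; destruct (Hd s Is) as [_ <-]; field; lra.
Qed.

(** * Regularity of functions built by products and composition *)

Lemma is_derive_Rcomp (F f : R -> R) (s dF df : R) :
  is_derive F (f s) dF -> is_derive f s df ->
  is_derive (fun t => F (f t)) s (dF * df).
Proof.
  intros HF Hf; rewrite Rmult_comm; exact (is_derive_comp F f s dF df HF Hf).
Qed.

(** Explicit derivatives in place of iterated [Derive] let the closure lemmas exhibit them by the
    product and chain rules; the translation to [C2_at] is made once. *)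
Definition C2 (f : R -> R) : Prop :=
  exists f1 f2 : R -> R, forall s,
    is_derive f s (f1 s) /\ is_derive f1 s (f2 s) /\ continuous f2 s.

Lemma C2_C2_at (f : R -> R) (s : R) : C2 f -> C2_at f s.
Proof.
  intros (f1 & f2 & H).
  assert (E1 : forall t, f1 t = Derive f t)
    by (intros t; symmetry; apply is_derive_unique, H).
  assert (E2 : forall t, f2 t = Derive (Derive f) t).
  { intros t; rewrite <- (Derive_ext _ _ t E1).
    symmetry; apply is_derive_unique, H. }
  destruct (H s) as (H1 & H2 & H3); split; [now eexists; exact H1 | split].
  - apply (ex_derive_ext f1); [exact E1 | eexists; exact H2].
  - now apply (continuous_ext f2).
Qed.

Lemma C2_mult (f g : R -> R) : C2 f -> C2 g -> C2 (fun t => f t * g t).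
Proof.
  intros (f1 & f2 & Hf) (g1 & g2 & Hg).
  exists (fun t => f1 t * g t + f t * g1 t),
    (fun t => (f2 t * g t + f1 t * g1 t) + (f1 t * g1 t + f t * g2 t)).
  intros s; destruct (Hf s) as (F1 & F2 & F3), (Hg s) as (G1 & G2 & G3).
  split; [ | split].
  - now apply is_derive_Rmult.
  - apply (is_derive_plus (V := R_NormedModule)); now apply is_derive_Rmult.
  - apply is_derive_continuous in F1, F2, G1, G2.
    apply (continuous_plus (V := R_NormedModule));
      apply (continuous_plus (V := R_NormedModule));
      now apply (continuous_mult (K := R_AbsRing)).
Qed.

(** The conditions on [F] are imposed only at values of [f], which admits [sqrt] of a positive
    function. *)
Lemma C2_comp (F F1 F2 f : R -> R) :
  (forall s, is_derive F (f s) (F1 (f s)) /\ is_derive F1 (f s) (F2 (f s)) /\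
             continuous F2 (f s)) ->
  C2 f -> C2 (fun t => F (f t)).
Proof.
  intros HF (f1 & f2 & Hf).
  exists (fun t => F1 (f t) * f1 t),
    (fun t => F2 (f t) * f1 t * f1 t + F1 (f t) * f2 t).
  intros s; destruct (Hf s) as (D1 & D2 & D3), (HF s) as (E1 & E2 & E3).
  split; [now apply is_derive_Rcomp | split].
  - apply (is_derive_Rmult (fun t => F1 (f t))); trivial.
    now apply is_derive_Rcomp.
  - apply is_derive_continuous in D1, D2, E2.
    assert (CF1 : continuous (fun t => F1 (f t)) s)
      by now apply (continuous_comp f F1).
    assert (CF2 : continuous (fun t => F2 (f t)) s)
      by now apply (continuous_comp f F2).
    apply (continuous_plus (V := R_NormedModule));
      repeat apply (continuous_mult (K := R_AbsRing)); assumption.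
Qed.

Lemma C2_sqrt (f : R -> R) :
  (forall s, 0 < f s) -> C2 f -> C2 (fun t => sqrt (f t)).
Proof.
  intros P; apply (C2_comp sqrt (fun v => / (2 * sqrt v))
    (fun v => - / (4 * v * sqrt v))).
  intros s; specialize (P s); generalize dependent (f s); intros v P.
  assert (Q : 0 < sqrt v) by now apply sqrt_lt_R0.
  assert (Q2 : sqrt v * sqrt v = v) by (apply sqrt_sqrt; lra).
  split; [ | split].
  - auto_derive; [trivial | field; lra].
  - auto_derive; [split; [trivial | split; [lra | trivial]] | ].
    set (q := sqrt v) in *; rewrite <- Q2; field; lra.
  - apply (ex_derive_continuous (fun v => - / (4 * v * sqrt v))).
    auto_derive; split; [trivial | split; [ | trivial]].
    apply Rgt_not_eq, Rmult_lt_0_compat; lra.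
Qed.

Lemma C2_cos (f : R -> R) : C2 f -> C2 (fun t => cos (f t)).
Proof.
  apply (C2_comp cos (fun v => - sin v) (fun v => - cos v)).
  intros s; split; [ | split].
  - apply is_derive_cos.
  - auto_derive; trivial; ring.
  - apply (ex_derive_continuous (fun v => - cos v)); now auto_derive.
Qed.

Lemma C2_sin (f : R -> R) : C2 f -> C2 (fun t => sin (f t)).
Proof.
  apply (C2_comp sin cos (fun v => - sin v)).
  intros s; split; [ | split].
  - apply is_derive_sin.
  - apply is_derive_cos.
  - apply (ex_derive_continuous (fun v => - sin v)); now auto_derive.
Qed.

Lemma C2_const (k : R) : C2 (fun _ => k).
Proof.
  exists (fun _ => 0), (fun _ => 0); intros s; split; [ | split].
  - apply (is_derive_const k).
  - apply (is_derive_const 0).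
  - apply continuous_const.
Qed.

(* Square of the height of the complete catenary: with w = z^2 - 1/2, the
   solution of w'^2 + 4 w^2 = 1 - 4 a^2 with w(0) = 0 and w'(0) > 0. *)
Definition height_sqr (a s : R) : R := 1 / 2 + sqrt (1 / 4 - a ^ 2) * sin (2 * s).

Definition height_sqr_deriv (a s : R) : R :=
  2 * sqrt (1 / 4 - a ^ 2) * cos (2 * s).

(** The sign [e], equal to 1 or -1, selects the hemisphere. *)
Definition height (a e s : R) : R := e * sqrt (height_sqr a s).

Definition longitude (a e s : R) : R :=
  RInt (fun t => a / (height a e t * (1 - height a e t ^ 2))) 0 s.

Definition catenary (a e s : R) : R3 :=
  (sqrt (1 - height_sqr a s) * cos (longitude a e s),
   sqrt (1 - height_sqr a s) * sin (longitude a e s),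
   height a e s).

(** * Properties of the complete catenary *)

Lemma is_derive_height_sqr (a s : R) :
  is_derive (height_sqr a) s (height_sqr_deriv a s).
Proof.
  unfold height_sqr, height_sqr_deriv; generalize (sqrt (1 / 4 - a ^ 2)).
  intros c; auto_derive; trivial; ring.
Qed.

(** With u = z^2 this is z'^2 = 1 - z^2 - a^2/z^2 multiplied by 4 z^2, a form free of
    denominators. *)
Lemma height_sqr_deriv_sqr (a s : R) : 0 < a < 1 / 2 ->
  height_sqr_deriv a s ^ 2
  = 4 * (height_sqr a s * (1 - height_sqr a s) - a ^ 2).
Proof.
  intros Ha; unfold height_sqr_deriv, height_sqr.
  assert (Q : sqrt (1 / 4 - a ^ 2) * sqrt (1 / 4 - a ^ 2) = 1 / 4 - a ^ 2)
    by (apply sqrt_sqrt; nra).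
  generalize (sin2_cos2 (2 * s)); unfold Rsqr; intros T.
  set (c := sqrt _) in *.
  replace (a ^ 2) with (1 / 4 - c * c) by lra.
  transitivity (4 * (c * c) * (cos (2 * s) * cos (2 * s))); [ring | ].
  replace (cos (2 * s) * cos (2 * s)) with (1 - sin (2 * s) * sin (2 * s))
    by lra; field.
Qed.

(** The identity above gives u (1 - u) = a^2 + u'^2/4 > 0. *)
Lemma height_sqr_bounds (a s : R) : 0 < a < 1 / 2 -> 0 < height_sqr a s < 1.
Proof.
  intros Ha; generalize (height_sqr_deriv_sqr a s Ha)
    (pow2_ge_0 (height_sqr_deriv a s)); intros E P.
  split; nra.
Qed.

Lemma C2_height_sqr (a : R) : C2 (height_sqr a).
Proof.
  exists (height_sqr_deriv a), (fun s => - 4 * sqrt (1 / 4 - a ^ 2) * sin (2 * s)).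
  intros s; split; [apply is_derive_height_sqr | split].
  - unfold height_sqr_deriv; generalize (sqrt (1 / 4 - a ^ 2)).
    intros c; auto_derive; trivial; ring.
  - apply (ex_derive_continuous
      (fun s => - 4 * sqrt (1 / 4 - a ^ 2) * sin (2 * s))); now auto_derive.
Qed.

Lemma height_pow2 (a e s : R) : 0 < a < 1 / 2 -> e = 1 \/ e = -1 ->
  height a e s ^ 2 = height_sqr a s.
Proof.
  intros Ha He; destruct (height_sqr_bounds a s Ha).
  unfold height; rewrite Rpow_mult_distr, pow2_sqrt by lra.
  destruct He as [-> | ->]; ring.
Qed.

Lemma height_sign (a e s : R) : 0 < a < 1 / 2 -> e = 1 \/ e = -1 ->
  0 < e * height a e s.
Proof.
  intros Ha He; destruct (height_sqr_bounds a s Ha) as [P _].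
  unfold height; apply sqrt_lt_R0 in P; destruct He as [-> | ->]; lra.
Qed.

Lemma height_neq_0 (a e s : R) : 0 < a < 1 / 2 -> e = 1 \/ e = -1 ->
  height a e s <> 0.
Proof. intros Ha He; generalize (height_sign a e s Ha He); nra. Qed.

Lemma C2_height (a e : R) : 0 < a < 1 / 2 -> C2 (height a e).
Proof.
  intros Ha; apply C2_mult; [apply C2_const | apply C2_sqrt].
  - intros s; now apply height_sqr_bounds.
  - apply C2_height_sqr.
Qed.

Lemma C2_horizontal_radius (a : R) : 0 < a < 1 / 2 ->
  C2 (fun s => sqrt (1 - height_sqr a s)).
Proof.
  intros Ha; apply C2_sqrt.
  - intros s; destruct (height_sqr_bounds a s Ha); lra.
  - destruct (C2_height_sqr a) as (f1 & f2 & H).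
    exists (fun s => 0 - f1 s), (fun s => 0 - f2 s); intros s.
    destruct (H s) as (H1 & H2 & H3); split; [ | split].
    + exact (is_derive_minus _ _ _ _ _ (is_derive_const 1 s) H1).
    + exact (is_derive_minus _ _ _ _ _ (is_derive_const 0 s) H2).
    + exact (continuous_minus _ _ _ (continuous_const 0 s) H3).
Qed.

Lemma is_derive_longitude (a e s : R) : 0 < a < 1 / 2 -> e = 1 \/ e = -1 ->
  is_derive (longitude a e) s (a / (height a e s * (1 - height a e s ^ 2))).
Proof.
  intros Ha He.
  apply (is_derive_RInt_interval m_infty p_infty
    (fun t => a / (height a e t * (1 - height a e t ^ 2)))); try easy.
  intros t _; destruct (C2_height a e Ha) as (z1 & z2 & Hz).
  eapply is_derive_continuous, is_derive_longitude_rate; [ | | apply Hz].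
  - now apply height_neq_0.
  - rewrite height_pow2 by trivial; now apply height_sqr_bounds.
Qed.

Lemma C2_longitude (a e : R) : 0 < a < 1 / 2 -> e = 1 \/ e = -1 ->
  C2 (longitude a e).
Proof.
  intros Ha He; destruct (C2_height a e Ha) as (z1 & z2 & Hz).
  set (G v := - a * (1 - 3 * v ^ 2) / (v * (1 - v ^ 2)) ^ 2).
  exists (fun s => a / (height a e s * (1 - height a e s ^ 2))),
    (fun s => G (height a e s) * z1 s).
  intros s; destruct (Hz s) as (Z1 & Z2 & _).
  assert (N := height_neq_0 a e s Ha He).
  assert (L : height a e s ^ 2 < 1)
    by (rewrite height_pow2 by trivial; now apply height_sqr_bounds).
  split; [now apply is_derive_longitude | split].
  - now apply is_derive_longitude_rate.
  - apply is_derive_continuous in Z1, Z2.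
    apply (continuous_mult (K := R_AbsRing)); trivial.
    apply (continuous_comp (height a e)); trivial.
    apply (ex_derive_continuous G); unfold G.
    clear Hz Z1 Z2; generalize dependent (height a e s); intros v N L.
    auto_derive; intros E; apply (pow_nonzero (v * (1 - v ^ 2)) 2).
    + apply Rmult_integral_contrapositive_currified; lra.
    + rewrite <- E; ring.
Qed.

Lemma is_derive_height (a e s : R) : 0 < a < 1 / 2 ->
  is_derive (height a e) s
    (e * (height_sqr_deriv a s / (2 * sqrt (height_sqr a s)))).
Proof.
  intros Ha; destruct (height_sqr_bounds a s Ha) as [P _].
  assert (D := is_derive_height_sqr a s); unfold height.
  auto_derive; [repeat split; trivial; now eexists; exact D | ].
  rewrite_derive D; apply sqrt_lt_R0 in P; field; lra.
Qed.

Lemma is_derive_horizontal_radius (a s : R) : 0 < a < 1 / 2 ->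
  is_derive (fun t => sqrt (1 - height_sqr a t)) s
    (- (height_sqr_deriv a s / (2 * sqrt (1 - height_sqr a s)))).
Proof.
  intros Ha; destruct (height_sqr_bounds a s Ha) as [_ P].
  assert (D := is_derive_height_sqr a s).
  assert (Q : 0 < sqrt (1 - height_sqr a s)) by (apply sqrt_lt_R0; lra).
  auto_derive.
  - split; [now eexists; exact D | split; [lra | trivial]].
  - rewrite_derive D; unfold Rminus in Q |- *; field; lra.
Qed.

Lemma catenary_spherical_curve (a e : R) :
  0 < a < 1 / 2 -> e = 1 \/ e = -1 ->
  spherical_curve m_infty p_infty (catenary a e).
Proof.
  intros Ha He s _.
  assert (Cr := C2_horizontal_radius a Ha).
  assert (Cl := C2_longitude a e Ha He).
  split; [apply C2_C2_at, C2_mult; trivial; now apply C2_cos | ].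
  split; [apply C2_C2_at, C2_mult; trivial; now apply C2_sin | ].
  split; [apply C2_C2_at; now apply C2_height | ].
  assert (Dr := is_derive_horizontal_radius a s Ha).
  assert (Dz := is_derive_height a e s Ha).
  assert (Dl := is_derive_longitude a e s Ha He).
  assert (Dx := is_derive_Rmult _ _ _ _ _ Dr
    (is_derive_Rcomp cos _ _ _ _ (is_derive_cos _) Dl)).
  assert (Dy := is_derive_Rmult _ _ _ _ _ Dr
    (is_derive_Rcomp sin _ _ _ _ (is_derive_sin _) Dl)).
  assert (Vx := is_derive_unique _ _ _ Dx : xc (velocity (catenary a e) s) = _).
  assert (Vy := is_derive_unique _ _ _ Dy : yc (velocity (catenary a e) s) = _).
  assert (Vz := is_derive_unique _ _ _ Dz : zc (velocity (catenary a e) s) = _).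
  rewrite Vx, Vy, Vz; unfold catenary, xc, yc, zc; simpl fst; simpl snd.
  rewrite (height_pow2 a e s) by trivial.
  destruct (height_sqr_bounds a s Ha) as [P0 P1].
  assert (E := height_sqr_deriv_sqr a s Ha).
  assert (T := sin2_cos2 (longitude a e s)); unfold Rsqr in T.
  unfold height.
  assert (Q : sqrt (height_sqr a s) * sqrt (height_sqr a s) = height_sqr a s)
    by (apply sqrt_sqrt; lra).
  assert (S : sqrt (1 - height_sqr a s) * sqrt (1 - height_sqr a s)
              = 1 - height_sqr a s) by (apply sqrt_sqrt; lra).
  assert (Pq : 0 < sqrt (height_sqr a s)) by now apply sqrt_lt_R0.
  assert (Ps : 0 < sqrt (1 - height_sqr a s)) by (apply sqrt_lt_R0; lra).
  assert (E1 : e * e = 1) by (destruct He as [-> | ->]; ring).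
  assert (Ne : e <> 0) by nra.
  set (q := sqrt (height_sqr a s)) in *.
  set (p := sqrt (1 - height_sqr a s)) in *.
  set (u := height_sqr a s) in *.
  set (d := height_sqr_deriv a s) in *.
  set (k := cos (longitude a e s)) in *.
  set (m := sin (longitude a e s)) in *.
  split.
  - transitivity (p * p * (m * m + k * k) + u); [ring | ].
    rewrite T, S; ring.
  (* The squared speed is p'^2 + p^2 lambda'^2 + z'^2 with p the horizontal radius, that is (d^2/4 +
     a^2) / (u (1 - u)), and d^2 = 4 (u (1 - u) - a^2) makes it 1. *)
  - transitivity (d ^ 2 * (m * m + k * k) / (4 * (p * p))
      + (p * p) * a ^ 2 * (m * m + k * k) / ((e * e) * (q * q) * (1 - u) ^ 2)
      + (e * e) * d ^ 2 / (4 * (q * q))).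
    + field; repeat split; lra.
    + rewrite T, S, Q, E1, E; field; lra.
Qed.

Lemma catenary_nonconstant_z (a e : R) : 0 < a < 1 / 2 -> e = 1 \/ e = -1 ->
  nonconstant_z m_infty p_infty (catenary a e).
Proof.
  (* At these points sin (2 s) is 0 and 1, so z^2 is the mean value 1/2 and the maximum. *)
  intros Ha He; exists 0, (PI / 4); split; [easy | split; [easy | ]].
  unfold catenary, zc; simpl; intros E.
  assert (E2 : height a e 0 ^ 2 = height a e (PI / 4) ^ 2) by now rewrite E.
  rewrite !height_pow2 in E2 by trivial; unfold height_sqr in E2.
  replace (2 * (PI / 4)) with (PI / 2) in E2 by field.
  rewrite Rmult_0_r, sin_0, sin_PI2 in E2.
  assert (0 < sqrt (1 / 4 - a ^ 2)) by (apply sqrt_lt_R0; nra); lra.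
Qed.

Lemma catenary_angular_momentum (a e : R) : 0 < a < 1 / 2 -> e = 1 \/ e = -1 ->
  is_function_of_z m_infty p_infty (catenary a e)
    (angular_momentum (catenary a e)) (fun z => 0 < e * z) (fun z => - a / z).
Proof.
  intros Ha He s Is; split; [now apply height_sign | ].
  rewrite (angular_momentum_polar m_infty p_infty (catenary a e)
    (fun t => sqrt (1 - height_sqr a t)) (longitude a e) s _
    (catenary_spherical_curve a e Ha He) Is
    (fun t _ => conj eq_refl eq_refl) (is_derive_longitude a e s Ha He)).
  assert (N := height_neq_0 a e s Ha He).
  destruct (height_sqr_bounds a s Ha) as [_ P].
  rewrite height_pow2, pow2_sqrt by trivial || lra.
  unfold catenary, zc; simpl; field; split; [trivial | lra].
Qed.

(** * Uniqueness up to motions, and the characterization *)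

Lemma momentum_unique (a e : R) (l r : Rbar) (xi : R -> R3) :
  0 < a < 1 / 2 -> e = 1 \/ e = -1 ->
  spherical_curve l r xi -> nonconstant_z l r xi ->
  is_function_of_z l r xi (angular_momentum xi)
    (fun z => 0 < e * z) (fun z => - a / z) ->
  exists s0 theta : R, forall s, in_interval l r s ->
    xi s = rotation_z theta (catenary a e (s + s0)).
Proof.
  intros Ha He Hxi NC HKe.
  assert (HK : is_function_of_z l r xi (angular_momentum xi)
    (fun z => z <> 0) (fun z => - a / z)).
  { intros s Is; destruct (HKe s Is) as [P K]; split; trivial.
    intros E; rewrite E in P; lra. }
  destruct (momentum_height a l r xi Ha Hxi NC HK) as [d Hd].
  (* Since 2 s + d = 2 (s + d/2), the phase d is the shift d/2 of arc length. *)
  assert (Eu : forall s, in_interval l r s ->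
    zc (xi s) ^ 2 = height_sqr a (s + d / 2)).
  { intros s Is; rewrite Hd by trivial; unfold height_sqr.
    do 3 f_equal; field. }
  assert (Ez : forall s, in_interval l r s ->
    zc (xi s) = height a e (s + d / 2)).
  { intros s Is; destruct (HKe s Is) as [P _].
    unfold height; rewrite <- Eu by trivial.
    destruct He as [-> | ->].
    - rewrite sqrt_pow2 by lra; ring.
    - replace (zc (xi s) ^ 2) with ((- zc (xi s)) ^ 2) by ring.
      rewrite sqrt_pow2 by lra; ring. }
  destruct NC as (t & _ & It & _).
  (* The heights agree, so the shifted longitude has the rate prescribed for [xi]; the remaining
     additive constant is the angle of rotation. *)
  destruct (momentum_longitude a l r xi (fun s => longitude a e (s + d / 2)) t)
    as [theta Ht]; trivial; [lra | | ].
  - intros s Is; rewrite Ez by trivial.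
    evar_last.
    + apply (is_derive_Rcomp (longitude a e) (fun s => s + d / 2)).
      * now apply is_derive_longitude.
      * auto_derive; [trivial | reflexivity].
    + apply Rmult_1_r.
  - exists (d / 2), theta; intros s Is.
    destruct (Ht s Is) as [Ex Ey].
    rewrite Eu in Ex, Ey by trivial.
    rewrite cos_plus in Ex; rewrite sin_plus in Ey.
    specialize (Ez s Is); unfold rotation_z, catenary, xc, yc, zc in *; simpl in *.
    destruct (xi s) as [[x y] z]; simpl in *.
    rewrite Ex, Ey, Ez; f_equal; f_equal; ring.
Qed.

(* The last clause is uniqueness up to rotations around the z-axis and choice
   of the origin of arc length: all the curves with the given momentum are,
   after these motions, arcs of a single complete curve.  The domain z <> 0 of
   K(z) = -a/z has two components, each of them preserved by these motions, so
   there is one complete curve in z > 0 (e = 1) and one in z < 0 (e = -1). *)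
Theorem corollary5p1 (a : R) (Ha : 0 < a < 1 / 2) :
  (forall (l r : Rbar) (xi : R -> R3),
     spherical_curve l r xi -> nonconstant_z l r xi ->
     (is_function_of_z l r xi (angular_momentum xi)
        (fun z => z <> 0) (fun z => - a / z)
      <-> catenary_longitude a l r xi) /\
     (catenary_longitude a l r xi <-> spherical_catenary 0 a l r xi) /\
     (catenary_longitude a l r xi ->
      is_function_of_z l r xi (geodesic_curvature xi)
        (fun z => z <> 0) (fun z => a / z ^ 2)))
  /\
  (forall e : R, e = 1 \/ e = -1 ->
     exists gam : R -> R3,
       spherical_curve m_infty p_infty gam /\
       nonconstant_z m_infty p_infty gam /\
       is_function_of_z m_infty p_infty gam (angular_momentum gam)
         (fun z => 0 < e * z) (fun z => - a / z) /\
       forall (l r : Rbar) (xi : R -> R3),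
         spherical_curve l r xi -> nonconstant_z l r xi ->
         is_function_of_z l r xi (angular_momentum xi)
           (fun z => 0 < e * z) (fun z => - a / z) ->
         exists s0 theta : R, forall s, in_interval l r s ->
           xi s = rotation_z theta (gam (s + s0))).
Proof.
  assert (Na : a <> 0) by lra.
  split.
  - intros l r xi Hxi NC.
    split; [ | split].
    + split; [ | now apply catenary_longitude_momentum].
      destruct NC as (t & _ & It & _).
      now apply (momentum_catenary_longitude a l r xi t).
    + split; [apply catenary_longitude_spherical_catenary | ].
      now apply spherical_catenary_catenary_longitude.
    + intros HL s Is.
      assert (HK := catenary_longitude_momentum a l r xi Hxi HL).
      split; [now apply HK | now apply (momentum_curvature a l r)].
  - intros e He; exists (catenary a e); split; [ | split; [ | split]].
    + now apply catenary_spherical_curve.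
    + now apply catenary_nonconstant_z.
    + now apply catenary_angular_momentum.
    + intros l r xi; now apply momentum_unique.
Qed.
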